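(* Let $R$ be a commutative ring with unity and let $Y\subseteq \mathrm{Spec}(R)$. If $Z=\mathrm{maxl}(PS\mathcal{H}_Y)\cup Y$, then $Z$ is a compactification of $Y$.
   Context: For $S\subseteq R$ and $a\in R$, $h_Y(S)=\{P\in Y: S\subseteq P\}$ and $h_Y(a)=h_Y(\{a\})$. For $T\subseteq Y$, $k(T)=\bigcap_{P\in T}P$ (with $k(\emptyset)=R$), and $kh_Y(S)$ means $k(h_Y(S))$. An ideal $I$ of $R$ is a strong $\mathcal{H}_Y$-ideal if $kh_Y(F)\subseteq I$ for every finite subset $F\subseteq I$. $PS\mathcal{H}_Y$ is the set of all proper strong $\mathcal{H}_Y$-ideals of $R$, and $\mathrm{maxl}(E)$ is the set of all maximal elements (under inclusion) of a family $E$. (Members of $\mathrm{maxl}(PS\mathcal{H}_Y)$ are prime ideals, so $Z\subseteq \mathrm{Spec}(R)$.) Every subset $W\subseteq\mathrm{Spec}(R)$ carries the Zariski topology, in which the sets $h_W(a)=\{P\in W: a\in P\}$, $a\in R$, form a base for the closed sets. A compactification of $Y$ is a compact space (every open cover has a finite subcover; no separation axiom) that contains $Y$ as a dense subspace. *)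

(* Defs.v *)
From HB Require Import structures.
From mathcomp Require Import all_boot all_order all_algebra.
From mathcomp Require Import all_classical all_reals all_analysis.

Set Implicit Arguments.
Unset Strict Implicit.
Unset Printing Implicit Defensive.

Import GRing.Theory.
Local Open Scope classical_set_scope.
Local Open Scope ring_scope.

(* Subsets of R, in particular ideals, are classical sets.  [comPzRingType]
   allows the zero ring, and [ideal] allows the improper ideal R: the
   library's [idealr_closed] excludes both. *)
Section Ideals.
Variable R : comPzRingType.
Implicit Types (I P S : set R) (Y T W : set (set R)).

Definition ideal I :=
  [/\ I 0, forall x y, I x -> I y -> I (x + y) & forall a x, I x -> I (a * x)].

Definition prime_ideal P :=
  [/\ ideal P, P <> setT & forall x y, P (x * y) -> P x \/ P y].

Definition Spec : set (set R) := [set P | prime_ideal P].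

Definition hull Y S : set (set R) := [set P | Y P /\ S `<=` P].

Definition kern T : set R := \bigcap_(P in T) P.

Definition strong_H_ideal Y I :=
  ideal I /\
  forall F : set R, finite_set F -> F `<=` I -> kern (hull Y F) `<=` I.

Definition PSH Y : set (set R) := [set I | strong_H_ideal Y I /\ I <> setT].

Definition maxl (E : set (set R)) : set (set R) :=
  [set M | E M /\ forall N, E N -> M `<=` N -> N = M].

Lemma ideal1 I : ideal I -> I 1 -> I = setT.
Proof.
move=> [_ _ IM] I1; apply/seteqP; split=> // x _.
by rewrite -[x]mulr1; exact: IM.
Qed.

(* The colon ideal (M : x) of a maximal M is again a strong H_Y-ideal. *)
Lemma maxl_PSH_prime Y : Y `<=` Spec -> maxl (PSH Y) `<=` Spec.
Proof.
move=> YS M [[[Mid Mst] MT] Mmax]; split=> // x y Mxy.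
have [Mx|nMx] := pselect (M x); [by left|right].
have [M0 MD MM] := Mid.
pose J : set R := [set r | M (x * r)].
suff <- : J = M by [].
apply: Mmax; last by move=> r Mr; exact: MM.
split; last by move=> JT; apply: nMx; rewrite -[x]mulr1; change (J 1); rewrite JT.
split; first split => [|r s Jr Js|a r Jr].
- by rewrite /J /= mulr0.
- by rewrite /J /= mulrDr; exact: MD.
- by rewrite /J /= mulrCA; exact: MM.
move=> F finF FJ r kr.
apply: (Mst ( *%R x @` F)); first exact: finite_image.
  by move=> _ [s Fs <-]; exact: FJ.
move=> P [YP xFP].
have [[P0 PD PM] _ Ppr] := YS _ YP.
have [Px|nPx] := pselect (P x); first by rewrite mulrC; exact: PM.
apply: PM; apply: kr; split=> // s Fs.
by case: (Ppr x s) => //; apply: xFP; exists s.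
Qed.

Lemma maxl_PSHU_prime Y : Y `<=` Spec -> maxl (PSH Y) `|` Y `<=` Spec.
Proof. by move=> YS P [/(maxl_PSH_prime YS)|/YS]. Qed.

End Ideals.

(* The subset W of Spec R as a space; the proof that W consists of prime ideals
   is what makes the sets h_W(a) a base for the closed sets of a topology. *)
Definition zariski (R : comPzRingType) (W : set (set R)) (WS : W `<=` @Spec R) :
  Type := set_type W.

Section Zariski.
Variables (R : comPzRingType) (W : set (set R)) (WS : W `<=` @Spec R).

HB.instance Definition _ := Choice.on (zariski WS).

Definition zariski_h (a : R) : set (zariski WS) :=
  [set P | hull W [set a] (\val P)].

Definition zariski_open : set_system (zariski WS) :=
  [set U | exists A : set R, ~` U = \bigcap_(a in A) zariski_h a].

Lemma zariski_hE a (P : zariski WS) : zariski_h a P <-> (\val P : set R) a.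
Proof.
split=> [[_ /(_ a)]|Pa]; first by apply.
by split=> [|b ->//]; exact/set_mem/(valP P).
Qed.

Lemma zariski_openT : zariski_open setT.
Proof.
exists setT; apply/seteqP; split=> // P /(_ 1 I) /zariski_hE P1 _.
have [Pid PT _] := WS (set_mem (valP P)).
exact/PT/ideal1.
Qed.

Lemma zariski_openI : setI_closed zariski_open.
Proof.
move=> U V [A UA] [B VB]; rewrite /zariski_open /= setCI UA VB.
exists [set ab | exists2 a, A a & exists2 b, B b & ab = a * b].
apply/seteqP; split=> [P UVP _ [a Aa [b Bb ->]]|P ABP].
  have [[_ _ PM] _ _] := WS (set_mem (valP P)).
  apply/zariski_hE; case: UVP => [/(_ a Aa)|/(_ b Bb)] /zariski_hE Pab.
    by rewrite mulrC; exact: PM.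
  exact: PM.
have [_ _ Ppr] := WS (set_mem (valP P)).
have [AP|/existsNP[a /not_implyP[Aa nPa]]] :=
  pselect (forall a, A a -> zariski_h a P); [by left|right] => b Bb.
have /zariski_hE /Ppr : zariski_h (a * b) P by apply: ABP; exists a => //; exists b.
by case=> /zariski_hE.
Qed.

Lemma zariski_open_bigcup (I : Type) (f : I -> set (zariski WS)) :
  (forall i, zariski_open (f i)) -> zariski_open (\bigcup_i f i).
Proof.
move=> fo; exists [set a | exists i, ~` f i `<=` zariski_h a].
rewrite setC_bigcup; apply/seteqP; split=> [P fP a [i fa]|P aP i _].
  exact/fa/fP.
have [A fA] := fo i; rewrite fA => a Aa; apply: aP; exists i.
by rewrite fA; exact: bigcap_inf.
Qed.

HB.instance Definition _ := isOpenTopological.Build (zariski WS)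
  zariski_openT zariski_openI zariski_open_bigcup.

Lemma zariski_closedE (C : set (zariski WS)) :
  closed C <-> exists A : set R, C = \bigcap_(a in A) zariski_h a.
Proof. by rewrite -openC /open /= /zariski_open /= setCK. Qed.

End Zariski.

Definition zariski_incl (R : comPzRingType) (V W : set (set R))
    (VS : V `<=` @Spec R) (WS : W `<=` @Spec R) (VW : V `<=` W) :
  zariski VS -> zariski WS := subfun VW.

Lemma zariski_inclE (R : comPzRingType) (V W : set (set R))
    (VS : V `<=` @Spec R) (WS : W `<=` @Spec R) (VW : V `<=` W)
    (P : zariski VS) :
  \val (zariski_incl WS VW P) = \val P.
Proof. by []. Qed.

(* X is a compactification of T, T being identified with a subset of X by i. *)
Definition compactification (T X : topologicalType) (i : T -> X) :=
  [/\ cover_compact [set: X],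
      injective i,
      (forall U : set T, open U <-> exists2 V : set X, open V & i @^-1` V = U)
    & dense (range i)].

(* Main.v *)
Require Import Defs.
From mathcomp Require Import all_boot all_order all_algebra.
From mathcomp Require Import all_classical all_reals all_analysis.

Local Open Scope classical_set_scope.

(** Call a set [A] of ring elements centered over [Y] when every finite subset
    of [A] lies in some member of [Y].  Since members of [Y] are proper ideals,
    this says that [kern (hull Y F)] is proper for every finite [F] included in
    [A]; these kernels form a directed family of ideals, and their union is the
    least strong H_Y-ideal containing [A].  So [A] is centered over [Y] iff it
    is included in a proper strong H_Y-ideal ([PSH_centered],
    [centered_strong_closure]).  Being centered is a condition on finite
    subsets, hence passes to unions of chains, and Zorn's lemma places every
    centered set inside a member of [maxl (PSH Y)] ([centered_sub_maxl]).

    Compactness of [Z] is the finite intersection property for the basic closed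
    sets: if finitely many elements of [A] always have a common point in [Z],
    then that point is in [Y] or is a proper strong H_Y-ideal, so [A] is
    centered over [Y] in both cases, and the maximal ideal given by Zorn's lemma
    is a common point in [Z] of all the closed sets indexed by [A]
    ([cover_compact_zariski]).

    Density of [Y] amounts to the inclusion of [kern Y] in every point of [Z].
    It holds because [kern Y] is the kernel of the hull of the empty set, which
    any strong H_Y-ideal contains ([kern_sub_maxl_PSHU]).  That [Y] has the
    subspace topology follows from the definition of the basic closed sets. *)

(** * Finite sets *)

(** A finite axiom of choice.  Both finiteness arguments below use it: to
    extract a finite subcover, and to replace finitely many finite sets
    witnessing membership in a directed union by a single one. *)
Lemma finite_selection {T I : Type} {r : I -> T -> Prop} {D : set I}
    {F : set T} :
    finite_set F -> (forall a, F a -> exists2 i, D i & r i a) ->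
  exists J, [/\ finite_set J, J `<=` D & forall a, F a -> exists2 i, J i & r i a].
Proof.
elim/Pchoice: T => T in r F *.
move=> /finite_seqP[s ->]; elim: s => [_|a s IHs sD].
  by exists set0; split=> // a.
have [x xs|J [finJ JD Js]] := IHs.
  by apply: sD; rewrite /= inE xs orbT.
have [|i Di ria] := sD a; first by rewrite /= mem_head.
exists (i |` J); split; first by rewrite finite_setU.
  by move=> x [->|/JD].
move=> x; rewrite /= inE => /orP[/eqP ->|/Js[k Jk rkx]].
  by exists i => //; left.
by exists k => //; right.
Qed.

Lemma finite_sub_chain {T : Type} {C : set (set T)} {F : set T} :
    C !=set0 -> total_on C subset -> finite_set F -> F `<=` \bigcup_(X in C) X ->
  exists2 X, C X & F `<=` X.
Proof.
elim/Pchoice: T => T in C F *.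
move=> [X0 CX0] Ctot /finite_seqP[s ->]; elim: s => [_|a s IHs sC].
  by exists X0.
have [x xs|X CX sX] := IHs.
  by apply: sC; rewrite /= inE xs orbT.
have [|Y CY Ya] := sC a; first by rewrite /= mem_head.
have [XY|YX] := Ctot _ _ CX CY.
  by exists Y => // x; rewrite /= inE => /orP[/eqP ->|/sX/XY].
by exists X => // x; rewrite /= inE => /orP[/eqP ->|/sX]; first exact: YX.
Qed.

(** * Centered sets and strong H-ideals *)

Section StrongIdeals.
Context {R : comPzRingType}.
Implicit Types (I M P S A F X : set R) (Y : set (set R)).

Lemma kern_hull_ideal {Y} S : Y `<=` @Spec R -> ideal (kern (hull Y S)).
Proof.
move=> YS; split=> [P [/YS[[P0 _ _] _ _] _]//|x y kx ky P hP|a x kx P hP].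
  have [/YS[[_ PD _] _ _] _] := hP.
  by apply: PD; [exact: kx|exact: ky].
have [/YS[[_ _ PM] _ _] _] := hP.
by apply: PM; exact: kx.
Qed.

Lemma hullS {Y S S'} : S `<=` S' -> hull Y S' `<=` hull Y S.
Proof. by move=> SS P [YP SP]; split=> // x /SS/SP. Qed.

Lemma kernS {T T' : set (set R)} : T `<=` T' -> kern T' `<=` kern T.
Proof. by move=> TT x kx P /TT; exact: kx. Qed.

Lemma sub_kern_hull {Y S} : S `<=` kern (hull Y S).
Proof. by move=> x Sx P [_]; apply. Qed.

Definition centered Y S :=
  forall F, finite_set F -> F `<=` S -> hull Y F !=set0.

Lemma centeredS {Y S S'} : S `<=` S' -> centered Y S' -> centered Y S.
Proof. by move=> SS cS F finF FS; apply: cS => // x /FS/SS. Qed.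

Lemma PSH_centered {Y M} : PSH Y M -> centered Y M.
Proof.
move=> [[Mid Mst] MT] F finF FM; apply/set0P/eqP => hF0; apply: MT.
by apply/seteqP; split=> // x _; apply: Mst FM _ _ => // P; rewrite hF0.
Qed.

(** When [Y] consists of prime ideals, this is the strong H_Y-ideal generated
    by [S]. *)
Definition strong_closure Y S : set R :=
  \bigcup_(F in [set F | finite_set F /\ F `<=` S]) kern (hull Y F).

Lemma sub_strong_closure {Y S} : S `<=` strong_closure Y S.
Proof.
move=> x Sx; exists [set x]; last exact: sub_kern_hull.
by split=> // y ->.
Qed.

(** The union is directed, as enlarging [F] enlarges [kern (hull Y F)]: this
    makes it an ideal.  A finite [G] inside it is included in one
    [kern (hull Y F)], and then [hull Y F `<=` hull Y G], so that
    [kern (hull Y G)] is included in the union too. *)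
Lemma centered_strong_closure {Y S} :
  Y `<=` @Spec R -> centered Y S -> PSH Y (strong_closure Y S).
Proof.
move=> YS cS; split; last first.
  move=> cT; have [F [finF FS] kF1] : strong_closure Y S 1%R by rewrite cT.
  have [P hP] := cS F finF FS; have [YP _] := hP.
  have [Pid PT _] := YS _ YP.
  by apply/PT/ideal1 => //; exact: kF1.
split.
  split=> [|x y [F [finF FS] kx] [G [finG GS] ky]|a x [F FS kx]].
  - exists set0; first by split.
    by have [] := @kern_hull_ideal Y set0 YS.
  - exists (F `|` G); first by rewrite /= finite_setU subUset.
    have [_ kD _] := @kern_hull_ideal Y (F `|` G) YS; apply: kD.
      by apply: kernS kx; exact/hullS/subsetUl.
    by apply: kernS ky; exact/hullS/subsetUr.
  - by exists F => //; have [_ _] := @kern_hull_ideal Y F YS; apply.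
move=> G finG Gc x kx.
have [J [finJ JS JG]] := finite_selection finG Gc.
exists (\bigcup_(F in J) F).
  split; first by apply: bigcup_finite => // F /JS[].
  by move=> y [F /JS[_ FS] /FS].
move=> P [YP JP]; apply: kx; split=> // g /JG[F JF]; apply.
by split=> // y Fy; apply: JP; exists F.
Qed.

(** Zorn's lemma is applied to sets of ring elements rather than to ideals: the
    strong H_Y-ideal generated by a set maximal for being centered together with
    [A] cannot be enlarged, since any larger member of [PSH Y] is centered. *)
Lemma centered_sub_maxl {Y A} :
  Y `<=` @Spec R -> centered Y A -> exists2 M, maxl (PSH Y) M & A `<=` M.
Proof.
move=> YS cA.
have [C Cc Ctot|X [cX Xmax]] := @Zorn_bigcup R (fun X => centered Y (A `|` X)).
  move=> F finF FAC.
  (* The empty set is added to the chain to make it nonempty. *)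
  pose C' := setU A @` (set0 |` C).
  have [||x /FAC|_ [X CX <-] FX] := @finite_sub_chain R C' F _ _ finF.
  - by exists (A `|` set0), set0 => //; left.
  - have tot0C : total_on (set0 |` C) subset.
      move=> X X' [->|CX] [->|CX'].
      + by left.
      + by left.
      + by right.
      + exact: Ctot.
    move=> _ _ [X CX <-] [X' CX' <-].
    by case: (tot0C X X' CX CX') => XX'; [left|right]; exact: setUS.
  - case=> [Ax|[X CX Xx]]; last by exists (A `|` X); [exists X => //|]; right.
    by exists (A `|` set0); [exists set0 => //; left|left].
  - by case: CX FX => [-> | /Cc cAX]; [rewrite setU0; exact: cA | exact: cAX].
pose M := strong_closure Y (A `|` X).
have PM : PSH Y M := centered_strong_closure YS cX.
have AXM : A `|` X `<=` M := sub_strong_closure.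
exists M; last by move=> x Ax; apply: AXM; left.
(* [M] is maximal because a larger proper [N] would be centered together with
   [A], whence [N `<=` X] by the maximality of [X]. *)
split=> // N PN MN.
have AXN : A `|` X `<=` N by exact: subset_trans AXM MN.
have NX : N `<=` X.
  apply: contrapT => nNX; apply: (Xmax N).
    by split=> // x Xx; apply: AXN; right.
  apply: centeredS (PSH_centered PN) => x [Ax|//].
  by apply: AXN; left.
by apply/seteqP; split=> // x /NX Xx; apply: AXM; right.
Qed.

End StrongIdeals.

(** * Zariski subspaces of the prime spectrum *)

Section Zariski.
Context {R : comPzRingType}.

(** For an open cover, [A] below collects the elements whose basic closed set
    contains the complement of some member of the cover.  These basic closed
    sets have no common point, so [A] is not centered over [W]: some finite [F]
    included in [A] has an empty hull, and one member of the cover for each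
    element of [F] gives a subcover. *)
Lemma cover_compact_zariski (W : set (set R)) (WS : W `<=` @Spec R) :
    (forall A : set R, centered W A -> exists2 P, W P & A `<=` P) ->
  cover_compact [set: zariski WS].
Proof.
move=> cW I D f fo Df.
pose A : set R := [set a | exists2 i, D i & ~` f i `<=` zariski_h (WS:=WS) a].
have [F [finF FA hF0]] : exists F, [/\ finite_set F, F `<=` A & hull W F = set0].
  apply: contrapT => nF.
  have [F finF FA|P WP AP] := cW A.
    by apply/set0P/eqP => hF0; apply: nF; exists F.
  pose p : zariski WS := SigSub (mem_set WP).
  have [i Di fip] := Df p Logic.I.
  have := fo i Di => -[B fiB].
  suff: (~` f i) p by apply.
  rewrite fiB => b Bb; apply/zariski_hE/AP; exists i => //.
  by rewrite fiB; exact: bigcap_inf.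
have [J [finJ JD JF]] := finite_selection finF FA.
exists (fset_set J) => [i|p _].
  by rewrite in_fset_set // => /set_mem/JD/mem_set.
have [a Fa npa] : exists2 a, F a & ~ (\val p : set R) a.
  apply: contrapT => nF; suff: hull W F (\val p) by rewrite hF0.
  split=> [|a Fa]; first exact/set_mem/(valP p).
  by apply: contrapT => npa; apply: nF; exists a.
have [i Ji fia] := JF a Fa; exists i; first by rewrite fset_setK.
by apply: contrapT => /fia/zariski_hE.
Qed.

Lemma kern_sub_maxl_PSHU (Y : set (set R)) P :
  (maxl (PSH Y) `|` Y) P -> kern Y `<=` P.
Proof.
move=> [[[[_ Pst] _] _]|YP] x kx; last exact: kx.
by apply: (Pst set0) => // Q [YQ _]; exact: kx.
Qed.

(** A nonempty open set contains the points avoiding [a], for some [a] that some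
    point [p] avoids; as [kern V] is included in [p], some member of [V] avoids
    [a] too. *)
Lemma dense_zariski_incl (V W : set (set R)) (VS : V `<=` @Spec R)
    (WS : W `<=` @Spec R) (VW : V `<=` W) :
    (forall P, W P -> kern V `<=` P) ->
  dense (range (zariski_incl WS VW : zariski VS -> zariski WS)).
Proof.
move=> kV O [p Op] [A OA].
have [a Aa npa] : exists2 a, A a & ~ (\val p : set R) a.
  apply: contrapT => nA; suff: (~` O) p by apply.
  rewrite OA => a Aa; apply/zariski_hE; apply: contrapT => npa.
  by apply: nA; exists a.
have [P VP nPa] : exists2 P, V P & ~ P a.
  apply: contrapT => nV; apply: npa.
  apply: (kV (\val p)); first exact/set_mem/(valP p).
  by move=> P VP; apply: contrapT => nPa; apply: nV; exists P.
pose q : zariski VS := SigSub (mem_set VP).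
exists (zariski_incl WS VW q); split; last by exists q.
apply: contrapT => nOq.
have : (~` O) (zariski_incl WS VW q) by [].
by rewrite OA => /(_ a Aa)/zariski_hE; exact: nPa.
Qed.

Lemma open_zariski_inclE (V W : set (set R)) (VS : V `<=` @Spec R)
    (WS : W `<=` @Spec R) (VW : V `<=` W) (U : set (zariski VS)) :
  open U <->
  exists2 O : set (zariski WS), open O & zariski_incl WS VW @^-1` O = U.
Proof.
have preE (A : set R) : zariski_incl WS VW @^-1`
    (\bigcap_(a in A) zariski_h (WS:=WS) a) =
    \bigcap_(a in A) zariski_h (WS:=VS) a.
  by apply/seteqP; split=> p hp a Aa; apply/zariski_hE;
    have /zariski_hE := hp a Aa.
split=> [[A UA]|[B [A BA] <-]]; last first.
  by exists A; rewrite -preE -BA.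
exists (~` \bigcap_(a in A) zariski_h (WS:=WS) a).
  by exists A; rewrite setCK.
by rewrite -preimage_setC preE -UA setCK.
Qed.

End Zariski.

Theorem theorem3p7 (R : comPzRingType) (Y : set (set R))
    (YS : Y `<=` @Spec R) :
  let Z := maxl (PSH Y) `|` Y in
  let ZS : Z `<=` @Spec R := maxl_PSHU_prime YS in
  let YZ : Y `<=` Z := @subsetUr _ (maxl (PSH Y)) Y in
  @compactification (zariski YS) (zariski ZS) (zariski_incl ZS YZ).
Proof.
move=> Z ZS YZ; split.
- apply: cover_compact_zariski => A cA.
  have [|M MP AM] := @centered_sub_maxl R Y A YS; last by exists M => //; left.
  move=> F finF /(cA F finF)[P [[[PP _]|YP] FP]]; last by exists P.
  exact: PSH_centered PP F finF FP.
- exact: subfun_inj.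
- exact: open_zariski_inclE.
- apply: dense_zariski_incl => P; exact: kern_sub_maxl_PSHU.
Qed.
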